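(* Let $\mathscr{O}$ be a compact Noetherian local ring with maximal ideal $\mathfrak{m}$ and $q=\#\mathscr{O}/\mathfrak{m}$. Suppose that $\mathbf{M} \sim \operatorname{SymHaar}(\mathscr{O}^{n\times n})$ and fix some integer $0\le k\leq n$. Then we have an equality in distribution of random $\mathscr{O}$-modules (up to isomorphism): $$\mathbb{P}\Bigl(\operatorname{coker}(\mathbf{M}) \in \ast \;\Big|\; \operatorname{rank}_{q}(\mathbf{M}) = n-k\Bigr) = \mathbb{P}\Bigl(\operatorname{coker}(\mathbf{K}) \in \ast \Bigr),$$ where $\mathbf{K} \sim \operatorname{SymHaar}(\mathfrak{m}^{k\times k})$ is a symmetric $k\times k$ matrix with entries Haar distributed on $\mathfrak{m}$.
   Context: Rings are commutative and unital. A Noetherian local ring $\mathscr{O}$ with maximal ideal $\mathfrak{m}$ carries the metric $d(x,y)=2^{-\nu(x-y)}$ with $\nu(r)=\sup\{k\ge0: r\in\mathfrak{m}^k\}$; ''compact'' means compact for this metric (in particular the residue field is finite). Then every ideal $\mathfrak{a}\subseteq\mathscr{O}$ (including $\mathfrak{a}=\mathscr{O}$) has a unique Haar probability measure, namely the unique probability measure on $\mathfrak{a}$ invariant under translation by elements of $\mathfrak{a}$. $\operatorname{SymHaar}(\mathfrak{a}^{n\times n})$ is the law of a random symmetric matrix whose entries on and above the diagonal are independent and Haar distributed on $\mathfrak{a}$. $\operatorname{rank}_q(\cdot)$ is the rank over $\mathbb{F}_q\cong\mathscr{O}/\mathfrak{m}$ of the reduction of a matrix modulo $\mathfrak{m}$.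 $\operatorname{coker}(\mathbf{X})=\mathscr{O}^n/\mathbf{X}\mathscr{O}^m$ for $\mathbf{X}\in\mathscr{O}^{n\times m}$ (the cokernel of the empty $0\times 0$ matrix is $0$). *)

(* Defs.v *)
From HB Require Import structures.
From mathcomp Require Import all_boot all_order all_algebra generic_quotient ring_quotient.
From mathcomp Require Import all_classical all_reals all_analysis.

Set Implicit Arguments.
Unset Strict Implicit.
Unset Printing Implicit Defensive.

Import Order.TTheory GRing.Theory Num.Theory.

Local Open Scope classical_set_scope.
Local Open Scope ring_scope.

Section Ideals.
Variable O : comNzRingType.
Implicit Types I J m : set O.

Definition is_ideal I : Prop :=
  [/\ I 0, (forall x y, I x -> I y -> I (x + y)) &
      forall c x, I x -> I (c * x)].

Definition is_maximal_ideal I : Prop :=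
  [/\ is_ideal I, ~ I 1 &
      forall J, is_ideal J -> ~ J 1 -> I `<=` J -> J = I].

Definition is_local_ring m : Prop :=
  is_maximal_ideal m /\ forall J, is_maximal_ideal J -> J = m.

Definition is_noetherian : Prop :=
  forall I, is_ideal I ->
  exists s : seq O,
    I = [set x | exists c : 'I_(size s) -> O, x = \sum_i c i * s`_i].

Definition ideal_mul I J : set O :=
  [set x | exists (r : nat) (u v : 'I_r -> O),
     [/\ forall i, I (u i), forall i, J (v i) & x = \sum_i u i * v i]].

Fixpoint ideal_pow m (k : nat) : set O :=
  if k is k'.+1 then ideal_mul m (ideal_pow m k') else setT.

Lemma ideal_pow_ideal m k : is_ideal (ideal_pow m k).
Proof.
elim: k => [|k [_ _ IH]] //=; split.
- by exists 0%N, (fun=> 0), (fun=> 0); split=> [[]//|[]//|]; rewrite big_ord0.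
- move=> _ _ [r [u [v [Iu Jv ->]]]] [s [u' [v' [Iu' Jv' ->]]]].
  exists (r + s)%N,
    (fun i => match fintype.split i with inl j => u j | inr j => u' j end),
    (fun i => match fintype.split i with inl j => v j | inr j => v' j end).
  split=> [i|i|]; [by case: fintype.split|by case: fintype.split|].
  rewrite big_split_ord /=; congr (_ + _); apply: eq_bigr => i _.
  + by rewrite -[lshift _ _]/(fintype.unsplit (inl i)) unsplitK.
  + by rewrite -[rshift _ _]/(fintype.unsplit (inr i)) unsplitK.
- move=> c _ [r [u [v [Iu Jv ->]]]]; exists r, u, (fun i => c * v i).
  split=> // [i|]; first exact: IH.
  by rewrite mulr_sumr; apply: eq_bigr => i _; rewrite mulrCA.
Qed.

Lemma ideal_powN m k x : ideal_pow m k x -> ideal_pow m k (- x).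
Proof. by have [_ _ Z] := ideal_pow_ideal m k; rewrite -mulN1r; exact: Z. Qed.

Lemma ideal_powS m k : ideal_pow m k.+1 `<=` ideal_pow m k.
Proof.
have [Z D M] := ideal_pow_ideal m k.
move=> _ [r [u [v [_ Jv ->]]]].
apply: big_ind => [|x y|i _]; [exact: Z|exact: D|exact/M/Jv].
Qed.

Lemma ideal_pow_le m j k : (j <= k)%N -> ideal_pow m k `<=` ideal_pow m j.
Proof.
move=> /subnK <-; elim: (k - j)%N => [|l IH] //.
by rewrite addSn; apply: subset_trans IH; exact: ideal_powS.
Qed.

End Ideals.

(* O with the topology of adic_dist below.  The metric separates points only
   when the powers of m intersect in 0 (Krull), so the instance is only
   pseudometric. *)
Definition adic (R : realType) (O : comNzRingType) (m : set O) : Type := O.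

Section AdicMetric.
Variables (R : realType) (O : comNzRingType) (m : set O).

(* \nu(r) = sup {k | r \in m^k}, possibly +oo. *)
Definition adic_val (r : O) : \bar R :=
  ereal_sup [set (k%:R)%:E | k in [set k | ideal_pow m k r]].

Definition adic_dist (x y : O) : R :=
  if adic_val (x - y) is v%:E then 2 `^ (- v) else 0.

Lemma adic_val_ge0 r : (0 <= adic_val r)%E.
Proof. by apply: ereal_sup_ubound; exists 0%N. Qed.

Lemma adic_valN r : adic_val (- r) = adic_val r.
Proof.
rewrite /adic_val; congr (ereal_sup [set _ | k in _]).
by apply/seteqP; split=> k /= /ideal_powN; rewrite ?opprK.
Qed.

Lemma adic_valD u v :
  (adic_val u <= adic_val (u + v))%E \/ (adic_val v <= adic_val (u + v))%E.
Proof.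
have [uv|/existsNP[k /not_implyP[uk nvk]]] :=
  pselect (forall k, ideal_pow m k u -> ideal_pow m k v).
- left; apply: ereal_sup_le => _ [k uk <-].
  exists k => //=; have [_ D _] := ideal_pow_ideal m k; apply: D => //; exact: uv.
- right; apply: ereal_sup_le => _ [j vj <-].
  exists j => //=; have [_ D _] := ideal_pow_ideal m j; apply: D => //.
  case: (leqP j k) => [jk|/ltnW kj]; first exact: (ideal_pow_le jk).
  by case: nvk; exact: (ideal_pow_le kj).
Qed.

Lemma adic_distxx x : adic_dist x x = 0.
Proof.
rewrite /adic_dist subrr; case E : (adic_val 0) => [v| |] //.
have : (((Num.bound v)%:R)%:E <= adic_val 0)%E.
  apply: ereal_sup_ubound; exists (Num.bound v) => //=.
  by case: (ideal_pow_ideal m (Num.bound v)).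
have v0 : 0 <= v by have := adic_val_ge0 0; rewrite E lee_fin.
by rewrite E lee_fin leNgt archi_boundP.
Qed.

Lemma adic_dist_sym x y : adic_dist x y = adic_dist y x.
Proof. by rewrite /adic_dist -opprB adic_valN. Qed.

Lemma adic_dist_ge0 x y : 0 <= adic_dist x y.
Proof. by rewrite /adic_dist; case: adic_val => // v; exact: powR_ge0. Qed.

Let adic_dist_le x y x' y' :
  (adic_val (x - y) <= adic_val (x' - y'))%E ->
  adic_dist x' y' <= adic_dist x y.
Proof.
rewrite /adic_dist; have := adic_val_ge0 (x' - y').
have := adic_val_ge0 (x - y).
case: (adic_val (x - y)) => [v| |]; case: (adic_val (x' - y')) => [w| |] //.
by rewrite !lee_fin => _ _ vw; rewrite ler_powR ?ler1n// lerN2.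
Qed.

Lemma adic_dist_triangle y x z :
  adic_dist x z <= adic_dist x y + adic_dist y z.
Proof.
have := adic_valD (x - y) (y - z); rewrite addrA subrK => -[] /adic_dist_le h.
- by apply: (le_trans h); rewrite lerDl adic_dist_ge0.
- by apply: (le_trans h); rewrite lerDr adic_dist_ge0.
Qed.

Local Notation adic := (adic R m).

HB.instance Definition _ := Choice.on adic.
HB.instance Definition _ := isPointed.Build adic (0 : O).

Let adic_ball (x : adic) (e : R) : set adic := [set y | adic_dist x y < e].
Let adic_ent : set_system (adic * adic) := entourage_ adic_ball.
Let adic_nbhs (x : adic) : set_system adic := nbhs_ adic_ent x.
Let adic_nbhsE : adic_nbhs = nbhs_ adic_ent. Proof. by []. Qed.

HB.instance Definition _ := hasNbhs.Build adic adic_nbhs.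

Let adic_ball_center x (e : R) : 0 < e -> adic_ball x e x.
Proof. by move=> e0; rewrite /adic_ball/= adic_distxx. Qed.

Let adic_ball_sym x y (e : R) : adic_ball x e y -> adic_ball y e x.
Proof. by rewrite /adic_ball/= adic_dist_sym. Qed.

Let adic_ball_triangle x y z e1 e2 :
  adic_ball x e1 y -> adic_ball y e2 z -> adic_ball x (e1 + e2) z.
Proof.
rewrite /adic_ball/= => ? ?.
by rewrite (le_lt_trans (adic_dist_triangle y _ _))// ltrD.
Qed.

Let adic_entE : adic_ent = entourage_ adic_ball. Proof. by []. Qed.

HB.instance Definition _ := @Nbhs_isPseudoMetric.Build R adic
  adic_ent adic_nbhsE adic_ball adic_ball_center adic_ball_sym
  adic_ball_triangle adic_entE.

(* O with its Borel sigma-algebra. *)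
Definition adic_borel := g_sigma_algebraType (@open adic).

(* The product sigma-algebra on r x s matrices, each entry being given the
   Borel sigma-algebra of O. *)
Definition matrix_measurable (r s : nat) : set (set 'M[O]_(r, s)) :=
  <<s [set E | exists (i : 'I_r) (j : 'I_s) (A : set adic_borel),
         measurable A /\ E = [set X : 'M[O]_(r, s) | A (X i j)]] >>.

End AdicMetric.

Section Cokernel.
Variables (O : comNzRingType) (r s : nat) (X : 'M[O]_(r, s)).

Definition colspace : {pred 'cV[O]_r} :=
  fun v => `[< exists w : 'cV[O]_s, v = X *m w >].

Lemma colspace_zmod_closed : zmod_closed colspace.
Proof.
split=> [|_ _ /asboolP[u ->] /asboolP[v ->]]; apply/asboolP.
- by exists 0; rewrite mulmx0.
- by exists (u - v); rewrite mulmxBr.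
Qed.

HB.instance Definition _ :=
  GRing.isZmodClosed.Build 'cV[O]_r colspace colspace_zmod_closed.

Definition coker : Type := (Quotient.quot colspace).

HB.instance Definition _ := GRing.Zmodule.on coker.

Definition coker_proj (v : 'cV[O]_r) : coker := (\pi_(Quotient.quot colspace) v)%qT.

Lemma coker_projP u v :
  coker_proj u = coker_proj v <-> exists w, u - v = X *m w.
Proof.
rewrite /coker_proj; split.
- by move/eqP; rewrite -Quotient.idealrBE => /asboolP.
- by move=> uv; apply/eqP; rewrite -Quotient.idealrBE; apply/asboolP.
Qed.

Lemma coker_projD u v : coker_proj (u + v) = coker_proj u + coker_proj v.
Proof. exact: Quotient.pi_add. Qed.

Definition coker_scale (c : O) (x : coker) : coker :=
  coker_proj (c *: (repr (x : (Quotient.quot colspace)))).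

Lemma coker_projZ c v : coker_scale c (coker_proj v) = coker_proj (c *: v).
Proof.
have /coker_projP[w E] : coker_proj (repr (coker_proj v : (Quotient.quot colspace))) =
  coker_proj v by exact: reprK.
by apply/coker_projP; exists (c *: w); rewrite -scalerBr E scalemxAr.
Qed.

Let projK (x : coker) : exists v, x = coker_proj v.
Proof. by exists (repr (x : (Quotient.quot colspace))); rewrite /coker_proj reprK. Qed.

Let coker_scalerA a b x :
  coker_scale a (coker_scale b x) = coker_scale (a * b) x.
Proof. by have [v ->] := projK x; rewrite !coker_projZ scalerA. Qed.

Let coker_scale1r : left_id 1 coker_scale.
Proof. by move=> x; have [v ->] := projK x; rewrite coker_projZ scale1r. Qed.

Let coker_scalerDr : right_distributive coker_scale +%R.
Proof.
move=> a x y; have [u ->] := projK x; have [v ->] := projK y.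
by rewrite -coker_projD !coker_projZ scalerDr coker_projD.
Qed.

Let coker_scalerDl x : {morph coker_scale^~ x : a b / a + b}.
Proof.
by move=> a b; have [v ->] := projK x; rewrite !coker_projZ scalerDl coker_projD.
Qed.

HB.instance Definition _ := GRing.Zmodule_isLmodule.Build O coker
  coker_scalerA coker_scale1r coker_scalerDr coker_scalerDl.

End Cokernel.

Definition module_iso (O : comNzRingType) (U V : lmodType O) : Prop :=
  exists f : {linear U -> V}, bijective f.

Definition iso_invariant (O : comNzRingType) (C : lmodType O -> Prop) : Prop :=
  forall U V : lmodType O, module_iso U V -> C U -> C V.

(* red exhibits F as the residue field O / m. *)
Definition is_residue_map (O : comNzRingType) (m : set O) (F : finFieldType)
    (red : {rmorphism O -> F}) : Prop :=
  (forall y, exists x, red x = y) /\ (forall x, red x = 0 <-> m x).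

Definition rank_q (O : comNzRingType) (F : finFieldType)
    (red : {rmorphism O -> F}) (r s : nat) (X : 'M[O]_(r, s)) : nat :=
  \rank (map_mx red X).

Definition sym_over (O : comNzRingType) (a : set O) (n : nat) : set 'M[O]_n :=
  [set X | X^T = X /\ forall i j, a (X i j)].

Arguments sym_over {O} a n.

Section Haar.
Variables (R : realType) (O : comNzRingType) (m : set O).

(* A probability measure on the ideal a is encoded as one on O of mass 1 on a;
   ideals of a Noetherian local ring are closed, hence Borel. *)
Definition is_haar (a : set O) (mu : probability (adic_borel R m) R) : Prop :=
  mu (a : set (adic_borel R m)) = 1%E /\
  forall (x : O) (A : set (adic_borel R m)), a x -> measurable A ->
    mu [set x + (y : O) | y in A] = mu A.

Definition SymHaar (a : set O) (n : nat) (d : measure_display)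
    (T : measurableType d) (P : probability T R) (X : T -> 'M[O]_n) : Prop :=
  [/\ forall w, sym_over a n (X w),
      forall i j,
        measurable_fun setT (fun w => X w i j : adic_borel R m),
      forall i j : 'I_n, (i <= j)%N ->
        exists2 mu : probability (adic_borel R m) R, is_haar a mu &
        forall A : set (adic_borel R m), measurable A ->
          P [set w | A (X w i j)] = mu A &
      forall A : 'I_n -> 'I_n -> set (adic_borel R m),
        (forall i j, measurable (A i j)) ->
        P [set w | forall i j : 'I_n, (i <= j)%N -> A i j (X w i j)] =
        (\prod_(p : 'I_n * 'I_n | (p.1 <= p.2)%N)
            P [set w | A p.1 p.2 (X w p.1 p.2)])%E].

(* The event "coker(X) \in C" on the space of symmetric n x n matrices over a.
   A class C of modules for which it is not measurable has no probability. *)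
Definition coker_event (a : set O) (n : nat) (C : lmodType O -> Prop) : Prop :=
  matrix_measurable R m (sym_over a n `&` [set X : 'M[O]_n | C (coker X)]).

End Haar.

Definition cond_prob (R : realType) (d : measure_display) (T : measurableType d)
    (P : probability T R) (A B : set T) : R :=
  fine (P (A `&` B)) / fine (P B).

(* Main.v *)
Require Import Defs.
From HB Require Import structures.
From mathcomp Require Import all_boot all_order all_algebra generic_quotient.
From mathcomp Require Import all_classical all_reals all_analysis.

Set Implicit Arguments.
Unset Strict Implicit.
Unset Printing Implicit Defensive.

Import Order.TTheory GRing.Theory Num.Theory.

Local Open Scope classical_set_scope.
Local Open Scope ring_scope.

(** The reduction of M modulo m is a symmetric matrix of rank r = n - k over the
residue field.  Its kernel splits off orthogonally, so some U in GL_n(O),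
depending on the reduction alone, makes U M U^T a block matrix
[[A, B], [B^T, D]] with A invertible over the local ring O and with B and D
zero modulo m.  Eliminating A changes the cokernel only up to isomorphism, so
coker M is isomorphic to coker phi(M), where phi(M) = D - B^T A^-1 B is the
Schur complement, a symmetric k x k matrix over m ([schur_sym],
[schur_coker]).

Adding the symmetric matrix U^-1 diag(0, E) U^-T to M, with E symmetric over m,
changes neither the reduction nor A and B, and replaces phi(M) by phi(M) + E
([corner_shift_schur]).  As the law of M is invariant under symmetric shifts,
the law of phi(M) on the event rank = r is invariant under shifts by symmetric
matrices over m; up to its total mass it must therefore be the law of K.

The measure theory takes place at finite level.  By compactness O / m^j is
finite for each j, so there are finitely many congruence classes of matrices
modulo m^j; the classes at all levels form a pi-system generating the product
sigma-algebra ([matrix_measurable_cylinders]).  A law on the symmetric matrices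
over an ideal that gives equal mass to all the classes of a level that meet
this set is unique ([uniform_law_unique]), and the Haar law has this property
([SymHaar_uniform]).  This uniqueness serves twice: to see that the shift
above, which is not a translation because it depends on the reduction of M,
preserves the law of M ([corner_shift_uniform]), and to compare phi(M) with K. *)

(** * Units and linear algebra over a local ring and its residue field *)

Section LocalRing.
Variables (O : comNzRingType) (m : set O).
Hypothesis hlocal : is_local_ring m.

(** A non-unit x generates a proper ideal; Zorn's lemma puts it inside a maximal
ideal, which can only be m. *)
Lemma local_unit x : ~ m x -> exists y, x * y = 1.
Proof.
move=> nmx; apply: contrapT => /forallNP nx.
(* The empty set is admitted only so that the union of the empty chain stays in
   the family. *)
pose P (I : set O) := I = set0 \/ [/\ is_ideal I, I x & ~ I 1].
have [F FP totF|J [PJ maxJ]] := @Zorn_bigcup O P.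
  have [[I [FI I0]]|noI] := pselect (exists I, F I /\ I !=set0); last first.
    left; rewrite -subset0 => y [I FI Iy].
    by apply: noI; exists I; split=> //; exists y.
  have FPn I' : F I' -> I' !=set0 -> [/\ is_ideal I', I' x & ~ I' 1].
    by move=> /FP[->[z]|].
  right; split; last 2 first.
  - by exists I => //; have [] := FPn _ FI I0.
  - by move=> [I' FI' I'1]; have [|_ _] := FPn _ FI'; [exists 1|apply].
  split.
  - by exists I => //; have [[]] := FPn _ FI I0.
  - move=> a b [I1 FI1 I1a] [I2 FI2 I2b].
    have [/(_ _ I1a) I2a|/(_ _ I2b) I1b] := totF _ _ FI1 FI2.
    + by exists I2 => //; have [|[_ D _] _ _] := FPn _ FI2; [exists b|exact: D].
    + by exists I1 => //; have [|[_ D _] _ _] := FPn _ FI1; [exists b|exact: D].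
  - move=> c a [I1 FI1 I1a]; exists I1 => //.
    by have [|[_ _ M] _ _] := FPn _ FI1; [exists a|exact: M].
pose X : set O := [set z | exists y, z = x * y].
have idX : is_ideal X.
  split; first by exists 0; rewrite mulr0.
  - by move=> _ _ [a ->] [b ->]; exists (a + b); rewrite mulrDr.
  - by move=> c _ [a ->]; exists (c * a); rewrite mulrCA.
have PX : P X.
  right; split=> //; first by exists 1; rewrite mulr1.
  by move=> [y y1]; exact: (nx y).
case: PJ => [J0|[idJ Jx J1]].
  by apply: (maxJ X) => //; rewrite J0 properEneq; split=> //;
     [apply/eqP => X0; have : set0 x by rewrite X0; exists 1; rewrite mulr1].
have Jm : J = m.
  apply: hlocal.2; split=> // J' idJ' J'1 JJ'; apply: contrapT => neJ.
  apply: (maxJ J'); first by rewrite properEneq; split=> //; apply/eqP => /esym.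
  by right; split=> //; exact: JJ'.
by apply: nmx; rewrite -Jm.
Qed.

Variables (F : finFieldType) (red : {rmorphism O -> F}).
Hypothesis hred : is_residue_map m red.

(** The determinant is a unit of O as soon as it is nonzero modulo m, and then
the adjugate provides the inverse. *)
Lemma residue_unit_mx n (A : 'M[O]_n) : map_mx red A \in unitmx ->
  exists B : 'M[O]_n, A *m B = 1%:M /\ B *m A = 1%:M.
Proof.
rewrite unitmxE unitfE det_map_mx => dA.
have [y dy] : exists y, \det A * y = 1.
  by apply: local_unit => /hred.2 /eqP; apply/negP.
exists (y *: \adj A); split.
- by rewrite -scalemxAr mul_mx_adj scale_scalar_mx mulrC dy.
- by rewrite -scalemxAl mul_adj_mx scale_scalar_mx mulrC dy.
Qed.

Lemma residue_inverse n : exists inv : 'M[O]_n -> 'M[O]_n,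
  forall A, map_mx red A \in unitmx ->
    A *m inv A = 1%:M /\ inv A *m A = 1%:M.
Proof.
have /choice[inv h] : forall A : 'M[O]_n, exists B, map_mx red A \in unitmx ->
    A *m B = 1%:M /\ B *m A = 1%:M.
  move=> A; have [/residue_unit_mx[B hB]|] := boolP (map_mx red A \in unitmx).
  - by exists B.
  - by exists 0.
by exists inv.
Qed.

Lemma residue_lift r s (A : 'M[F]_(r, s)) :
  exists B : 'M[O]_(r, s), map_mx red B = A.
Proof.
have /choice[lift liftK] := hred.1.
by exists (map_mx lift A); apply/matrixP => i j; rewrite !mxE liftK.
Qed.

End LocalRing.

(** Gaussian elimination supplies U such that the last k rows of U A vanish; the
last k columns of U A U^T then vanish by symmetry, in every characteristic. *)
Lemma symmetric_rank_split (F : fieldType) r k (A : 'M[F]_(r + k)) :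
  A^T = A -> \rank A = r ->
  exists2 U : 'M[F]_(r + k), U \in unitmx &
  exists2 B : 'M[F]_r, B \in unitmx & U *m A *m U^T = block_mx B 0 0 0.
Proof.
move=> symA rkA; pose U := invmx (col_ebase A).
have Uu : U \in unitmx by rewrite unitmx_inv col_ebase_unit.
have UA : U *m A = pid_mx r *m row_ebase A.
  rewrite -[X in _ *m X = _](mulmx_ebase A) rkA -mulmxA /U.
  by rewrite mulKmx ?col_ebase_unit.
exists U => //; set N := U *m A *m U^T.
have symN : N^T = N by rewrite /N !trmx_mul trmxK symA mulmxA.
have dN : dsubmx N = 0.
  rewrite /N UA pid_mx_block block_mxEv row_mx0 !mul_col_mx !mul0mx.
  exact: col_mxKd.
have NE : N = block_mx (ulsubmx N) 0 0 0.
  rewrite -[LHS]submxK; congr block_mx.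
  - by rewrite -[LHS]trmxK trmx_ursub symN /dlsubmx dN linear0 trmx0.
  - by rewrite /dlsubmx dN linear0.
  - by rewrite /drsubmx dN linear0.
exists (ulsubmx N) => //.
have rkN : \rank N = r.
  rewrite /N mxrankMfree ?row_free_unit ?unitmx_tr//.
  by rewrite eqmxMfull // row_full_unit.
rewrite -row_free_unit /row_free -[X in _ == X]rkN [in X in _ == X]NE.
by rewrite block_mxEv row_mx0 rank_col_mx0 rank_row_mx0.
Qed.

(** * Cokernels and Schur complements *)

Lemma module_iso_sym (O : comNzRingType) (U V : lmodType O) :
  module_iso U V -> module_iso V U.
Proof.
move=> [f [g fK gK]].
pose L := GRing.isLinear.Build O V U _ g (can2_linear fK gK).
pose h : {linear V -> U} := HB.pack g L.
by exists h, f.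
Qed.

Section CokernelIso.
Variable O : comNzRingType.

Lemma coker_projK r s (X : 'M[O]_(r, s)) (x : coker X) :
  coker_proj X (repr (x : Quotient.quot (colspace X))) = x.
Proof. exact: reprK. Qed.

Lemma coker_proj_scale r s (X : 'M[O]_(r, s)) c v :
  c *: coker_proj X v = coker_proj X (c *: v).
Proof. exact: coker_projZ. Qed.

(** The matrices p and q descend to the cokernels by the first two equations,
and the last two make the induced maps inverse to each other. *)
Lemma coker_iso_of_mx r s r' s' (X : 'M[O]_(r, s)) (Y : 'M[O]_(r', s'))
    (p : 'M[O]_(r', r)) (q : 'M[O]_(r, r')) a b c e :
  p *m X = Y *m a -> q *m Y = X *m b ->
  q *m p - 1%:M = X *m c -> p *m q - 1%:M = Y *m e ->
  module_iso (coker X) (coker Y).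
Proof.
move=> pX qY qp pq.
pose push r1 s1 (X1 : 'M[O]_(r1, s1)) r2 s2 (X2 : 'M[O]_(r2, s2))
  (f : 'M[O]_(r2, r1)) (x : coker X1) : coker X2 :=
  coker_proj X2 (f *m repr (x : Quotient.quot (colspace X1))).
have pushE r1 s1 (X1 : 'M[O]_(r1, s1)) r2 s2 (X2 : 'M[O]_(r2, s2)) f g :
    f *m X1 = X2 *m g ->
    forall v, push _ _ X1 _ _ X2 f (coker_proj X1 v) = coker_proj X2 (f *m v).
  move=> fX v; apply/coker_projP.
  have /coker_projP[w E] := coker_projK (coker_proj X1 v).
  by exists (g *m w); rewrite -mulmxBr E [LHS]mulmxA fX mulmxA.
have lin : linear (push _ _ X _ _ Y p).
  move=> t x y; rewrite -(coker_projK x) -(coker_projK y).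
  rewrite coker_proj_scale -coker_projD !(pushE _ _ _ _ _ _ _ _ pX).
  by rewrite coker_proj_scale -coker_projD mulmxDr -scalemxAr.
pose L := GRing.isLinear.Build O (coker X) (coker Y) _ (push _ _ X _ _ Y p) lin.
pose f : {linear coker X -> coker Y} := HB.pack (push _ _ X _ _ Y p) L.
exists f; exists (push _ _ Y _ _ X q) => x; rewrite -(coker_projK x) /=.
- rewrite (pushE _ _ _ _ _ _ _ _ pX) (pushE _ _ _ _ _ _ _ _ qY).
  apply/coker_projP; exists (c *m repr (x : Quotient.quot (colspace X))).
  by rewrite !mulmxA -qp mulmxBl mul1mx.
- rewrite (pushE _ _ _ _ _ _ _ _ qY) (pushE _ _ _ _ _ _ _ _ pX).
  apply/coker_projP; exists (e *m repr (x : Quotient.quot (colspace Y))).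
  by rewrite !mulmxA -pq mulmxBl mul1mx.
Qed.

(** Block elimination.  The row operation [-C A^-1, 1] maps the column space of
N to that of the Schur complement S, and the inclusion of the last k
coordinates is its inverse modulo the column space of N. *)
Lemma coker_schur r k (X U V : 'M[O]_(r + k)) (A' : 'M[O]_r) :
  let N := U *m X *m U^T in
  U *m V = 1%:M -> V *m U = 1%:M ->
  ulsubmx N *m A' = 1%:M -> A' *m ulsubmx N = 1%:M ->
  module_iso (coker X)
    (coker (drsubmx N - dlsubmx N *m A' *m ursubmx N)).
Proof.
move=> N UV VU AA' A'A.
have UVT : U^T *m V^T = 1%:M by rewrite -trmx_mul VU trmx1.
have VUT : V^T *m U^T = 1%:M by rewrite -trmx_mul UV trmx1.
have NE : N = block_mx (ulsubmx N) (ursubmx N) (dlsubmx N) (drsubmx N).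
  by rewrite submxK.
have XE : X = V *m N *m V^T.
  by rewrite /N !mulmxA VU mul1mx -mulmxA UVT mulmx1.
(* Only the block form of N matters from here on. *)
clearbody N; rewrite {}XE {X}.
move: NE AA' A'A; move: (ulsubmx N) (ursubmx N) (dlsubmx N) (drsubmx N).
move=> A B C D -> {N} AA' A'A; set S := D - _; pose l := - (C *m A').
have lN : row_mx l 1%:M *m block_mx A B C D = row_mx 0 S.
  rewrite mul_row_block /l !mul1mx !mulNmx -(mulmxA C A' A) A'A mulmx1 addNr.
  by rewrite addrC.
apply: (@coker_iso_of_mx _ _ _ _ _ _ (row_mx l 1%:M *m U) (V *m col_mx 0 1%:M)
  (row_mx 0 1%:M *m V^T) (U^T *m col_mx (- (A' *m B)) 1%:M)
  (U^T *m block_mx (- A') 0 0 0 *m U) 0).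
- rewrite !mulmxA -(mulmxA _ U V) UV mulmx1 lN.
  by rewrite mul_mx_row mulmx0 mulmx1.
- rewrite !mulmxA -(mulmxA _ V^T) VUT mulmx1 -!mulmxA; congr (V *m _).
  rewrite mul_block_col mul_col_mx mul0mx mul1mx !mulmx1 !mulmxN !mulmxA.
  by rewrite AA' mul1mx addNr addrC.
- rewrite !mulmxA -(mulmxA _ V^T) VUT mulmx1 -[in LHS]VU -mulmxBl.
  rewrite -(mulmxA V) -[X in _ - X]mulmx1 -mulmxBr -!mulmxA; congr (V *m _).
  rewrite !mulmxA; congr (_ *m U).
  rewrite mulmx_block !mulmx0 !addr0 mulmxN AA'.
  rewrite mul_col_row !mul0mx !mul1mx.
  rewrite (scalar_mx_block _ _ 1) opp_block_mx add_block_mx.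
  by rewrite !add0r !oppr0 ?addr0 ?add0r subrr /l mulmxN.
- rewrite !mulmxA -(mulmxA _ U V) UV mulmx1 mul_row_col mulmx0 add0r mul1mx.
  by rewrite subrr mulmx0.
Qed.

End CokernelIso.

(** * Congruence of matrices modulo powers of m *)

Section Congruence.
Variables (O : comNzRingType) (m : set O).

(** Level j means modulo m^(j+1): congruent matrices then have the same
reduction to the residue field at every level. *)
Definition mx_congr j r s (X Y : 'M[O]_(r, s)) : Prop :=
  forall i l, ideal_pow m j.+1 (X i l - Y i l).

Lemma ideal_pow0 j : ideal_pow m j 0.
Proof. by case: (ideal_pow_ideal m j). Qed.

Lemma ideal_powD j x y :
  ideal_pow m j x -> ideal_pow m j y -> ideal_pow m j (x + y).
Proof. by case: (ideal_pow_ideal m j) => _ D _; exact: D. Qed.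

Lemma ideal_powMl j c x : ideal_pow m j x -> ideal_pow m j (c * x).
Proof. by case: (ideal_pow_ideal m j) => _ _ M; exact: M. Qed.

Lemma ideal_pow_sym j x y : ideal_pow m j (x - y) -> ideal_pow m j (y - x).
Proof. by rewrite -opprB => /ideal_powN; rewrite opprK. Qed.

Lemma ideal_pow_trans j y x z :
  ideal_pow m j (x - y) -> ideal_pow m j (y - z) -> ideal_pow m j (x - z).
Proof. by move=> xy yz; rewrite -(subrK y x) -addrA; exact: ideal_powD. Qed.

Lemma ideal_powS_sub j : is_ideal m -> ideal_pow m j.+1 `<=` m.
Proof.
move=> [m0 mD mM] _ [r [u [v [mu _ ->]]]].
by apply: big_ind => // i _; rewrite mulrC; exact: mM.
Qed.

Lemma mx_congr_refl j r s (X : 'M[O]_(r, s)) : mx_congr j X X.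
Proof. by move=> i l; rewrite subrr; exact: ideal_pow0. Qed.

Lemma mx_congr_sym j r s (X Y : 'M[O]_(r, s)) :
  mx_congr j X Y -> mx_congr j Y X.
Proof. by move=> XY i l; exact: ideal_pow_sym. Qed.

Lemma mx_congr_trans j r s (Y X Z : 'M[O]_(r, s)) :
  mx_congr j X Y -> mx_congr j Y Z -> mx_congr j X Z.
Proof. by move=> XY YZ i l; exact: ideal_pow_trans (XY i l) (YZ i l). Qed.

Lemma mx_congr_le i j r s (X Y : 'M[O]_(r, s)) :
  (i <= j)%N -> mx_congr j X Y -> mx_congr i X Y.
Proof. by move=> ij XY a b; exact: (ideal_pow_le (m := m) (k := j.+1)). Qed.

Lemma mx_congrD j r s (X Y X' Y' : 'M[O]_(r, s)) :
  mx_congr j X Y -> mx_congr j X' Y' -> mx_congr j (X + X') (Y + Y').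
Proof. by move=> XY XY' i l; rewrite !mxE opprD addrACA; exact: ideal_powD. Qed.

Lemma mx_congrN j r s (X Y : 'M[O]_(r, s)) :
  mx_congr j X Y -> mx_congr j (- X) (- Y).
Proof. by move=> XY i l; rewrite !mxE -opprD; exact: ideal_powN. Qed.

Lemma mx_congrM j r s t (X Y : 'M[O]_(r, s)) (X' Y' : 'M[O]_(s, t)) :
  mx_congr j X Y -> mx_congr j X' Y' -> mx_congr j (X *m X') (Y *m Y').
Proof.
move=> XY XY' i l; rewrite !mxE -sumrB; apply: big_ind => [|x y|a _].
- exact: ideal_pow0.
- exact: ideal_powD.
- apply: (@ideal_pow_trans _ (Y i a * X' a l)).
  + by rewrite -mulrBl mulrC; exact: ideal_powMl.
  + by rewrite -mulrBr; exact: ideal_powMl.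
Qed.

(** This is X^-1 - Y^-1 = X^-1 (Y - X) Y^-1, written for one-sided inverses. *)
Lemma mx_congr_inv j r (X Y X' Y' : 'M[O]_r) :
  X' *m X = 1%:M -> Y *m Y' = 1%:M -> mx_congr j X Y -> mx_congr j X' Y'.
Proof.
move=> X'X YY' XY; have -> : Y' = X' *m X *m Y' by rewrite X'X mul1mx.
have {1}-> : X' = X' *m Y *m Y' by rewrite -mulmxA YY' mulmx1.
apply: mx_congrM (mx_congr_refl _ _); apply: mx_congrM (mx_congr_refl _ _) _.
exact: mx_congr_sym.
Qed.

Lemma mx_congr_submx j r1 r2 s1 s2 (X Y : 'M[O]_(r1 + r2, s1 + s2)) :
  mx_congr j X Y ->
  [/\ mx_congr j (ulsubmx X) (ulsubmx Y), mx_congr j (ursubmx X) (ursubmx Y),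
      mx_congr j (dlsubmx X) (dlsubmx Y) & mx_congr j (drsubmx X) (drsubmx Y)].
Proof. by move=> XY; split=> i l; rewrite !mxE; exact: XY. Qed.

Lemma mx_congr_red (F : finFieldType) (red : {rmorphism O -> F})
    (hm : is_ideal m) (hred : is_residue_map m red) j r s (X Y : 'M[O]_(r, s)) :
  mx_congr j X Y -> map_mx red X = map_mx red Y.
Proof.
move=> XY; apply/matrixP => i l; rewrite !mxE; apply/eqP.
by rewrite -subr_eq0 -rmorphB; apply/eqP/hred.2/(ideal_powS_sub hm)/XY.
Qed.

End Congruence.

(** * Cosets of powers of m in the adic topology *)

Section AdicTopology.
Variables (R : realType) (O : comNzRingType) (m : set O).
Local Notation adic := (adic R m).

(** The supremum defining the valuation need not be attained, so a strict bound
is what yields membership in m^j. *)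
Lemma adic_dist_lt j (x y : O) :
  adic_dist R m x y < 2 `^ (- j%:R) -> ideal_pow m j (x - y).
Proof.
move=> dxy; have : ((j%:R)%:E < adic_val R m (x - y))%E.
  move: dxy; rewrite /adic_dist; have := adic_val_ge0 R m (x - y).
  case: (adic_val R m (x - y)) => [v _| |//]; last by rewrite ltry.
  by rewrite lte_fin; apply: contraTT; rewrite -!leNgt => vj;
    rewrite ler_powR ?ler1n// lerN2.
move=> /ereal_sup_gt[_ [k /= mk <-]]; rewrite lte_fin ltr_nat => /ltnW jk.
exact: (ideal_pow_le jk).
Qed.

Lemma adic_dist_le j (x y : O) :
  ideal_pow m j (x - y) -> adic_dist R m x y <= 2 `^ (- j%:R).
Proof.
move=> mj; have : ((j%:R)%:E <= adic_val R m (x - y))%E.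
  by apply: ereal_sup_ubound; exists j.
rewrite /adic_dist; case: (adic_val R m (x - y)) => [v| |]; rewrite ?powR_ge0//.
by rewrite lee_fin => jv; rewrite ler_powR ?ler1n// lerN2.
Qed.

Lemma coset_open j c : open ([set y | ideal_pow m j (y - c)] : set adic).
Proof.
rewrite openE => y /= yc; apply/nbhs_ballP.
exists (2 `^ (- j%:R)) => [|z /= yz]; first exact: powR_gt0.
by apply: ideal_pow_trans yc; apply/ideal_pow_sym/adic_dist_lt.
Qed.

Lemma open_coset (A : set adic) (x : adic) : open A -> A x ->
  exists j, forall y : O, ideal_pow m j.+1 (y - x) -> A y.
Proof.
rewrite openE => /[apply] /nbhs_ballP[e /= e0 eA].
have [j /= je] : exists j : nat, 1 / 2 ^+ j < e.
  have [N _ /(_ N (leqnn N))] := near_infty_natSinv_expn_lt (PosNum e0).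
  by exists N.
exists j => y yx; apply: eA; apply: le_lt_trans je.
apply: le_trans (adic_dist_le (j := j) _) _.
  exact/ideal_pow_sym/ideal_powS.
by rewrite powRN powR_mulrn ?ler0n// div1r.
Qed.

Hypothesis hcompact : compact [set: adic].

(** Finitely many cosets of m^j cover O; rho x is the index of the first coset
of the cover that contains x. *)
Lemma finite_residues j : exists (N : nat) (rho : O -> 'I_N),
  forall x y, rho x = rho y <-> ideal_pow m j (x - y).
Proof.
have := hcompact; rewrite compact_cover.
move=> /(_ O setT (fun c => [set y | ideal_pow m j (y - c)])) []; last first.
- move=> D _ cov; set s := finmap.enum_fset D.
  have hs x : has (fun c => `[< ideal_pow m j (x - c) >]) s.
    have [c /= cD xc] := cov x I.
    by apply/hasP; exists c => //; apply/asboolP.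
  exists (size s), (fun x => Ordinal (etrans (esym (has_find _ s)) (hs x))).
  move=> x y; split=> [/(congr1 val)/= fxy|mxy].
  + have /asboolP xc := nth_find 0 (hs x).
    have /asboolP yc := nth_find 0 (hs y).
    by apply: ideal_pow_trans xc _; rewrite fxy; apply: ideal_pow_sym.
  + apply: val_inj; apply: eq_find => c; apply: asbool_equiv_eq; split.
    * by apply: ideal_pow_trans; exact: ideal_pow_sym.
    * exact: ideal_pow_trans.
- by move=> x _; exists x => //=; rewrite subrr; exact: ideal_pow0.
- by move=> c _; exact: coset_open.
Qed.

Lemma finite_mx_residues j r s : exists (I : finType) (rho : 'M[O]_(r, s) -> I),
  forall X Y, rho X = rho Y <-> mx_congr m j X Y.
Proof.
have [N [rho rhoP]] := finite_residues j.+1.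
exists {ffun 'I_r * 'I_s -> 'I_N}, (fun X => [ffun p => rho (X p.1 p.2)]).
move=> X Y; split=> [/ffunP XY i l|XY].
  by apply/rhoP; have := XY (i, l); rewrite !ffunE.
by apply/ffunP => p; rewrite !ffunE; apply/rhoP.
Qed.

End AdicTopology.

(** * Congruence classes generate the product sigma-algebra *)

Lemma sigma_algebra_bigcup_countable (T : Type) (G : set (set T))
    (I : countType) (F : I -> set T) :
  (forall i, <<s G >> (F i)) -> <<s G >> (\bigcup_i F i).
Proof.
move=> sF; pose F' n := if unpickle n is Some i then F i else set0.
suff -> : \bigcup_i F i = \bigcup_n F' n.
  apply: sigma_algebra_bigcup => n; rewrite /F'.
  by case: (unpickle n) => [i|]; [exact: sF|exact: sigma_algebra0].
apply/seteqP; split=> [x [i _ Fx]|x [n _]].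
  by exists (pickle i) => //; rewrite /F' pickleK.
by rewrite /F'; case: (unpickle n) => // i Fx; exists i.
Qed.

Section Cylinders.
Variables (R : realType) (O : comNzRingType) (m : set O).
Local Notation adic := (adic R m).
Hypothesis hcompact : compact [set: adic].

Definition cylinders r s : set (set 'M[O]_(r, s)) :=
  [set E | E = set0 \/ exists j D, E = [set X | mx_congr m j X D]].

(** As in an ultrametric space, two congruence classes that meet are nested. *)
Lemma cylinders_setI r s : setI_closed (@cylinders r s).
Proof.
move=> A B [->|[j [D ->]]]; first by left; rewrite set0I.
move=> [->|[j' [D' ->]]]; first by left; rewrite setI0.
have [[Z [ZD ZD']]|no] :=
    pselect (exists Z, mx_congr m j Z D /\ mx_congr m j' Z D'); last first.
  by left; rewrite -subset0 => Z [ZD ZD']; apply: no; exists Z.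
right; exists (maxn j j'), Z; apply/seteqP; split=> X /=.
  move=> [XD XD']; rewrite /maxn; case: ifP => _.
  - exact: mx_congr_trans XD' (mx_congr_sym ZD').
  - exact: mx_congr_trans XD (mx_congr_sym ZD).
move=> XZ; split.
- by apply: mx_congr_trans ZD; apply: mx_congr_le XZ; exact: leq_maxl.
- by apply: mx_congr_trans ZD'; apply: mx_congr_le XZ; exact: leq_maxr.
Qed.

(** Such a set S is a union of classes of level j, which are finite in number. *)
Lemma saturated_cylinders j r s (S : set 'M[O]_(r, s)) :
  (forall X Y, mx_congr m j X Y -> S X -> S Y) -> <<s @cylinders r s >> S.
Proof.
move=> satS; have [I [rho rhoP]] := finite_mx_residues hcompact j r s.
pose Fi (i : I) := [set X | S X /\ rho X = i].
have -> : S = \bigcup_i Fi i.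
  by apply/seteqP; split=> [X SX|X [i _ []]//]; exists (rho X).
apply: sigma_algebra_bigcup_countable => i; apply: sub_sigma_algebra.
have [[Z [SZ Zi]]|no] := pselect (exists Z, S Z /\ rho Z = i); last first.
  by left; rewrite -subset0 => Z [SZ Zi]; apply: no; exists Z.
right; exists j, Z; apply/seteqP; split=> X /=.
  by move=> [_ Xi]; apply/rhoP; rewrite Xi.
by move=> XZ; split; [exact: satS (mx_congr_sym XZ) SZ|rewrite -Zi; apply/rhoP].
Qed.

(** An open set A of O is the increasing union over j of the sets of points whose
coset modulo m^(j+1) lies in A, and the condition that one entry belongs to
such a set depends only on the matrix modulo m^(j+1). *)
Lemma matrix_measurable_cylinders r s :
  @matrix_measurable R O m r s `<=` <<s @cylinders r s >>.
Proof.
apply: smallest_sub; first exact: smallest_sigma_algebra.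
move=> _ [i [l [A [mA ->]]]].
pose H := [set B : set O | <<s @cylinders r s >> [set X | B (X i l)]].
suff : <<s @open adic >> `<=` H by apply.
apply: smallest_sub.
  split.
  - exact: sigma_algebra0.
  - by move=> B HB; rewrite /H /= /setD/=; have := sigma_algebraCD HB.
  - by move=> B HB; exact: (sigma_algebra_bigcup HB).
move=> B oB; rewrite /H /=.
pose Bj j := [set X : 'M[O]_(r, s) |
  forall y, ideal_pow m j.+1 (y - X i l) -> B y].
have BE : [set X : 'M[O]_(r, s) | B (X i l)] = \bigcup_j Bj j.
  apply/seteqP; split=> [X /= /(open_coset oB)[j hj]|X [j _]].
    by exists j.
  by apply; rewrite subrr; exact: ideal_pow0.
suff : <<s @cylinders r s >> (\bigcup_j Bj j) by rewrite -BE.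
apply: sigma_algebra_bigcup => j; apply: (@saturated_cylinders j) => X Y XY BX y.
by move=> yY; apply: BX; apply: ideal_pow_trans yY _; exact/ideal_pow_sym/XY.
Qed.

End Cylinders.

(** * Laws giving equal mass to all congruence classes *)

Section UniformLaw.
Variables (R : realType) (O : comNzRingType) (m : set O).
Hypothesis hcompact : compact [set: adic R m].
Variables (a : set O) (n : nat).

(** The law of X restricted to the event B, without normalisation: this describes
conditional laws without any division. *)
Definition uniform_law d (T : measurableType d) (P : probability T R)
    (B : set T) (X : T -> 'M[O]_n) : Prop :=
  [/\ measurable B,
      forall w, B w -> sym_over a n (X w),
      forall j D, measurable (B `&` [set w | mx_congr m j (X w) D]) &
      forall j D D', sym_over a n D -> sym_over a n D' ->
        P (B `&` [set w | mx_congr m j (X w) D]) =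
        P (B `&` [set w | mx_congr m j (X w) D'])].

(** N counts the classes of level j that meet the symmetric matrices over a.  It
is chosen before the law, so that it is the same for any two laws. *)
Lemma uniform_law_cylinder j : exists N : nat,
  forall d (T : measurableType d) (P : probability T R) (B : set T) X D,
  uniform_law P B X -> sym_over a n D ->
  P B = (N%:R%:E * P (B `&` [set w | mx_congr m j (X w) D]))%E.
Proof.
have [I [rho rhoP]] := finite_mx_residues hcompact j n n.
pose p (i : I) := `[< exists Z, sym_over a n Z /\ rho Z = i >].
exists #|p| => d T P B X D [mB symX mX PX] symD.
have Bi i Z : rho Z = i ->
    B `&` [set w | rho (X w) = i] = B `&` [set w | mx_congr m j (X w) Z].
  by move=> <-; congr (_ `&` _); apply/seteqP; split=> w /= /rhoP.
have mBi i : measurable (B `&` [set w | rho (X w) = i]).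
  have [[Z /Bi->//]|nZ] := pselect (exists Z, rho Z = i).
  suff -> : B `&` [set w | rho (X w) = i] = set0 by [].
  by rewrite -subset0 => w [_ Xi]; apply: nZ; exists (X w).
have {1}-> : B = \bigcup_(i in [set` index_enum I])
    (B `&` [set w | rho (X w) = i]).
  apply/seteqP; split=> [w Bw|w [i _ []]//].
  by exists (rho (X w)) => //=; exact: mem_index_enum.
rewrite measure_fin_bigcup//; last first.
  by move=> i i' _ _ [w [[_ <-] [_ <-]]].
rewrite -fsbig_seq ?index_enum_uniq// (bigID p)/= [X in (_ + X)%E]big1.
  have fc := fin_num_measure P _ (mX j D); rewrite adde0 -(fineK fc).
  rewrite (eq_bigr (fun=>
      (fine (P (B `&` [set w | mx_congr m j (X w) D])))%:E)).
    by rewrite sumEFin sumr_const -[in LHS]mulr_natl EFinM.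
  move=> i /asboolP[Z [symZ Zi]]; rewrite (fineK fc) (Bi _ _ Zi).
  exact: PX.
move=> i /asboolP np; have -> : B `&` [set w | rho (X w) = i] = set0.
  rewrite -subset0 => w [Bw Xi]; apply: np; exists (X w).
  by split=> //; exact: symX.
exact: measure0.
Qed.

(** By independence the mass of a class is the product of the masses of cosets
of m^(j+1) for the entries on and above the diagonal, and each Haar measure is
invariant under the shift carrying the coset of one element of a onto that of
another. *)
Lemma SymHaar_uniform d (T : measurableType d) (P : probability T R)
    (X : T -> 'M[O]_n) :
  is_ideal a -> SymHaar m a P X -> uniform_law P setT X.
Proof.
move=> [_ aD aM] [symX mX haarX indepX].
have mcoset j c : measurable
    ([set y | ideal_pow m j (y - c)] : set (adic_borel R m)).
  by apply: sub_sigma_algebra; exact: coset_open.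
split=> // [j D|j D D' [symD aDD] [symD' aDD']].
  rewrite setTI.
  have -> : [set w | mx_congr m j (X w) D] =
      \bigcap_(p in [set: 'I_n * 'I_n])
        [set w | ideal_pow m j.+1 (X w p.1 p.2 - D p.1 p.2)].
    apply/seteqP; split=> w /= Xw; [by move=> p _; exact: Xw|].
    by move=> i l; exact: (Xw (i, l)).
  apply: fin_bigcap_measurable; first exact: finite_finset.
  by move=> p _; have := mX p.1 p.2 measurableT _ (mcoset j.+1 (D p.1 p.2));
    rewrite setTI.
pose cyl (Z : 'M[O]_n) i l : set (adic_borel R m) :=
  [set y | ideal_pow m j.+1 (y - Z i l)].
have cylE (Z : 'M[O]_n) : Z^T = Z -> [set w | mx_congr m j (X w) Z] =
    [set w | forall i l : 'I_n, (i <= l)%N -> cyl Z i l (X w i l)].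
  move=> symZ; apply/seteqP; split=> w /= Xw i l; first by move=> _; exact: Xw.
  have [il|/ltnW li] := leqP i l; first exact: Xw.
  have [symXw _] := symX w; rewrite -symXw -symZ !mxE; exact: Xw.
rewrite !setTI !cylE// !indepX; try by move=> i l; exact: mcoset.
apply: eq_bigr => -[i l] /= il; have [mu [_ haarmu] lawX] := haarX i l il.
rewrite !lawX; try exact: mcoset.
rewrite -[RHS](haarmu (D i l - D' i l)); last 2 first.
- by apply: aD => //; rewrite -mulN1r; exact: aM.
- exact: mcoset.
congr (mu _); apply/seteqP; split=> [y /= yD|_ [y /= yD' <-]].
- exists (y - (D i l - D' i l)); last by rewrite addrC subrK.
  by rewrite /cyl /= opprB addrA addrAC addrK.
- by rewrite /cyl /= addrAC [D i l - _]addrC addrK addrC.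
Qed.

Variables (d : measure_display) (T : measurableType d) (P : probability T R).
Variables (B : set T) (X : T -> 'M[O]_n).
Variables (d' : measure_display) (T' : measurableType d').
Variables (P' : probability T' R) (Y : T' -> 'M[O]_n).
Hypotheses (hX : uniform_law P B X) (hY : uniform_law P' setT Y).

Let agree (E : set 'M[O]_n) : Prop :=
  [/\ measurable (B `&` X @^-1` E), measurable (Y @^-1` E) &
      P (B `&` X @^-1` E) = (P B * P' (Y @^-1` E))%E].

(* Both sides count the same N classes of equal mass; a class without symmetric
   matrix over a has mass 0 for both laws. *)
Let agree_cylinder E : @cylinders _ m n n E -> agree E.
Proof.
have [mB symX mX PX] := hX; have [_ symY mY PY] := hY.
case=> [->|[j [D ->]]].
  by split; rewrite ?preimage_set0 ?setI0 ?measure0 ?mule0.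
rewrite /agree; have -> : Y @^-1` [set Z | mx_congr m j Z D] =
    setT `&` [set w | mx_congr m j (Y w) D] by rewrite setTI.
split; [exact: mX|exact: mY|].
have [[D' [symD' DD']]|nD] :=
    pselect (exists D', sym_over a n D' /\ mx_congr m j D' D); last first.
  rewrite [X in P X](_ : _ = set0) ?[X in P' X](_ : _ = set0).
  - by rewrite !measure0 mule0.
  - rewrite -subset0 => w [_ Yw]; apply: nD; exists (Y w).
    by split=> //; exact: symY.
  - rewrite -subset0 => w [Bw Xw]; apply: nD; exists (X w).
    by split=> //; exact: symX.
have cD S (Z : S -> 'M[O]_n) :
    [set w | mx_congr m j (Z w) D] = [set w | mx_congr m j (Z w) D'].
  apply/seteqP; split=> w /= Zw; apply: mx_congr_trans Zw _ => //.
  exact: mx_congr_sym.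
have [N cylN] := uniform_law_cylinder j.
have XN := cylN _ _ _ _ _ _ hX symD'; have YN := cylN _ _ _ _ _ _ hY symD'.
rewrite (_ : X @^-1` _ = [set w | mx_congr m j (X w) D])// !cD XN.
by rewrite muleAC -YN probability_setT mul1e.
Qed.

(** The sets on which the two laws agree, up to the mass of B, form a Dynkin
system that contains the pi-system of congruence classes. *)
Lemma uniform_law_unique E : <<s @cylinders _ m n n >> E ->
  [/\ measurable (B `&` X @^-1` E), measurable (Y @^-1` E) &
      P (B `&` X @^-1` E) = (P B * P' (Y @^-1` E))%E].
Proof.
have [mB _ _ _] := hX.
rewrite -setI_closed_g_dynkin_g_sigma_algebra; last exact: cylinders_setI.
suff : <<d @cylinders _ m n n >> `<=` agree by apply.
apply: smallest_sub; last exact: agree_cylinder.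
split.
- by split; rewrite ?preimage_setT ?setIT// probability_setT mule1.
- move=> A [mX mY PE].
  have XC : B `&` X @^-1` (~` A) = B `\` (B `&` X @^-1` A).
    by rewrite preimage_setC setDE setCI setIUr setICr set0U.
  split.
  + by rewrite XC; exact: measurableD.
  + by rewrite preimage_setC; exact: measurableC.
  + have fB := fin_num_measure P _ mB; have fY := fin_num_measure P' _ mY.
    rewrite XC preimage_setC probability_setC// measureD//; last first.
      by rewrite -ge0_fin_numE.
    rewrite setIA setIid [X in (_ - X)%E]PE muleBr ?mule1// fin_num_adde_defr.
- move=> A tA agreeA.
  have mXA k : measurable (B `&` X @^-1` (A k)) by have [] := agreeA k.
  have mYA k : measurable (Y @^-1` (A k)) by have [] := agreeA k.
  rewrite /agree !preimage_bigcup setI_bigcupr.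
  split; [exact: bigcup_measurable|exact: bigcup_measurable|].
  rewrite !measure_semi_bigcup//; last 4 first.
  + by move=> i k _ _ [w [Ai Ak]]; apply: tA => //; exists (Y w).
  + exact: bigcup_measurable.
  + apply: trivIset_setIl => i k _ _ [w [Ai Ak]].
    by apply: tA => //; exists (X w).
  + exact: bigcup_measurable.
  rewrite -(fineK (fin_num_measure P _ mB)) -nneseriesZl//.
  apply: eq_eseriesr => k _; have [_ _ PE] := agreeA k.
  by rewrite [LHS]PE fineK//; exact: fin_num_measure.
Qed.

End UniformLaw.

(** * The Schur complement attached to a reduction *)

Section SchurReduction.
Variables (O : comNzRingType) (m : set O).
Hypothesis hlocal : is_local_ring m.
Variables (F : finFieldType) (red : {rmorphism O -> F}).
Hypothesis hred : is_residue_map m red.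
Variables r k : nat.

Definition symmetric_of_rank (A : 'M[F]_(r + k)) : Prop := A^T = A /\ \rank A = r.

(** U depends on X only through its reduction, so it stays constant when X varies
in a congruence class.  For the remaining reductions U and V are the identity,
which keeps the shift below a bijection of all matrices. *)
Lemma residue_splitting : exists U V : 'M[F]_(r + k) -> 'M[O]_(r + k),
  [/\ forall A, U A *m V A = 1%:M, forall A, V A *m U A = 1%:M &
      forall A, symmetric_of_rank A -> exists2 B : 'M[F]_r, B \in unitmx &
        map_mx red (U A) *m A *m (map_mx red (U A))^T = block_mx B 0 0 0].
Proof.
have /choice[UV hUV] : forall A : 'M[F]_(r + k),
  exists UV : 'M[O]_(r + k) * 'M[O]_(r + k),
    [/\ UV.1 *m UV.2 = 1%:M, UV.2 *m UV.1 = 1%:M &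
      symmetric_of_rank A -> exists2 B : 'M[F]_r, B \in unitmx &
        map_mx red UV.1 *m A *m (map_mx red UV.1)^T = block_mx B 0 0 0].
  move=> A; have [[symA rkA]|nA] := pselect (symmetric_of_rank A); last first.
    by exists (1%:M, 1%:M); rewrite /= mulmx1; split.
  have [U0 U0u U0A] := symmetric_rank_split symA rkA.
  have [U UE] := residue_lift hred U0.
  have [|V [UV VU]] := residue_unit_mx hlocal hred (A := U); first by rewrite UE.
  by exists (U, V); rewrite /= UE; split.
by exists (fst \o UV), (snd \o UV); split=> A; have [] := hUV A.
Qed.

Variables U V : 'M[F]_(r + k) -> 'M[O]_(r + k).
Variable inv : 'M[O]_r -> 'M[O]_r.
Hypothesis UV : forall A, U A *m V A = 1%:M.
Hypothesis VU : forall A, V A *m U A = 1%:M.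
Hypothesis U_split : forall A, symmetric_of_rank A ->
  exists2 B : 'M[F]_r, B \in unitmx &
  map_mx red (U A) *m A *m (map_mx red (U A))^T = block_mx B 0 0 0.
Hypothesis invP : forall A, map_mx red A \in unitmx ->
  A *m inv A = 1%:M /\ inv A *m A = 1%:M.

Definition congruent_form (X : 'M[O]_(r + k)) : 'M[O]_(r + k) :=
  U (map_mx red X) *m X *m (U (map_mx red X))^T.

Definition schur (N : 'M[O]_(r + k)) : 'M[O]_k :=
  drsubmx N - dlsubmx N *m inv (ulsubmx N) *m ursubmx N.

(** The shift is chosen so that it adds D to the lower right block of U X U^T. *)
Definition corner_shift (D : 'M[O]_k) (X : 'M[O]_(r + k)) : 'M[O]_(r + k) :=
  X + V (map_mx red X) *m block_mx 0 0 0 D *m (V (map_mx red X))^T.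

Let idm : is_ideal m. Proof. by case: hlocal => -[]. Qed.

Let form_red X : symmetric_of_rank (map_mx red X) ->
  exists2 B : 'M[F]_r, B \in unitmx &
  map_mx red (congruent_form X) = block_mx B 0 0 0.
Proof.
move=> /U_split[B Bu BE]; exists B => //.
by rewrite /congruent_form !map_mxM -map_trmx.
Qed.

Let ul_inv X : symmetric_of_rank (map_mx red X) ->
  ulsubmx (congruent_form X) *m inv (ulsubmx (congruent_form X)) = 1%:M /\
  inv (ulsubmx (congruent_form X)) *m ulsubmx (congruent_form X) = 1%:M.
Proof.
move=> /form_red[B Bu BE]; apply: invP.
by rewrite map_ulsubmx BE block_mxKul.
Qed.

Let inv_uniq (A B B' : 'M[O]_r) : A *m B = 1%:M -> B' *m A = 1%:M -> B' = B.
Proof. by move=> AB B'A; rewrite -(mulmx1 B') -AB mulmxA B'A mul1mx. Qed.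

(** The lower left block of U X U^T vanishes modulo m, so the Schur complement
reduces to the lower right block, which vanishes modulo m as well. *)
Lemma schur_sym X : X^T = X -> symmetric_of_rank (map_mx red X) ->
  sym_over m k (schur (congruent_form X)).
Proof.
move=> symX goodX; have [AA' A'A] := ul_inv goodX.
set N := congruent_form X in AA' A'A *.
have symN : N^T = N by rewrite /N /congruent_form !trmx_mul trmxK symX mulmxA.
split.
  have sA : (ulsubmx N)^T = ulsubmx N by rewrite trmx_ulsub symN.
  have sA' : (inv (ulsubmx N))^T = inv (ulsubmx N).
    by apply: (inv_uniq AA'); rewrite -{2}sA -trmx_mul AA' trmx1.
  rewrite /schur linearB /= !trmx_mul sA' trmx_drsub trmx_dlsub trmx_ursub symN.
  by rewrite mulmxA.
have [B _ BE] := form_red goodX.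
have dlE : map_mx red (dlsubmx N) = 0 by rewrite map_dlsubmx BE block_mxKdl.
have : map_mx red (schur N) = 0.
  rewrite /schur map_mxB !map_mxM dlE !mul0mx subr0 map_drsubmx BE.
  by rewrite block_mxKdr.
by move=> /matrixP E i l; apply/hred.2; have := E i l; rewrite !mxE.
Qed.

Lemma schur_coker X : symmetric_of_rank (map_mx red X) ->
  module_iso (coker X) (coker (schur (congruent_form X))).
Proof. by move=> /ul_inv[AA' A'A]; exact: (coker_schur (UV _) (VU _) AA' A'A). Qed.

Lemma schur_congr j X Y : symmetric_of_rank (map_mx red X) -> mx_congr m j X Y ->
  mx_congr m j (schur (congruent_form X)) (schur (congruent_form Y)).
Proof.
move=> goodX XY; have XYr := mx_congr_red idm hred XY.
have goodY : symmetric_of_rank (map_mx red Y) by rewrite -XYr.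
have [_ X'X] := ul_inv goodX; have [YY' _] := ul_inv goodY.
have NXY : mx_congr m j (congruent_form X) (congruent_form Y).
  rewrite /congruent_form XYr; apply: mx_congrM (mx_congr_refl _ _ _).
  exact: mx_congrM (mx_congr_refl _ _ _) _.
have [ul ur dl dr] := mx_congr_submx NXY.
apply: mx_congrD dr _; apply: mx_congrN; apply: mx_congrM ur.
by apply: mx_congrM dl _; exact: mx_congr_inv X'X YY' ul.
Qed.

Lemma corner_shift_red D X : sym_over m k D ->
  map_mx red (corner_shift D X) = map_mx red X.
Proof.
move=> [_ mD]; rewrite /corner_shift map_mxD !map_mxM.
have -> : map_mx red (block_mx 0 0 0 D) = (0 : 'M[F]_(r + k)).
  rewrite map_block_mx !map_mx0; have -> : map_mx red D = 0.
    by apply/matrixP => i l; rewrite !mxE; apply/hred.2.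
  by rewrite block_mxEv !row_mx0 col_mx0.
by rewrite mulmx0 mul0mx addr0.
Qed.

Lemma corner_shift_schur D X : sym_over m k D ->
  schur (congruent_form (corner_shift D X)) = schur (congruent_form X) + D.
Proof.
move=> hD; have -> : congruent_form (corner_shift D X) =
    congruent_form X + block_mx 0 0 0 D.
  rewrite /congruent_form corner_shift_red// /corner_shift.
  set A := map_mx red X; rewrite mulmxDr mulmxDl; congr (_ + _).
  by rewrite !mulmxA UV mul1mx -mulmxA -trmx_mul UV trmx1 mulmx1.
rewrite -[congruent_form X]submxK add_block_mx !addr0.
by rewrite /schur !(block_mxKul, block_mxKur, block_mxKdl, block_mxKdr) addrAC.
Qed.

Lemma corner_shiftK D D' X : sym_over m k D -> D + D' = 0 ->
  corner_shift D' (corner_shift D X) = X.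
Proof.
move=> hD DD'; rewrite {1}/corner_shift corner_shift_red// /corner_shift.
rewrite -addrA -mulmxDl -mulmxDr add_block_mx !addr0 DD'.
rewrite (_ : block_mx 0 0 0 0 = 0) ?mulmx0 ?mul0mx ?addr0//.
by rewrite block_mxEv !row_mx0 col_mx0.
Qed.

Lemma corner_shift_congr j D X Y :
  mx_congr m j X Y -> mx_congr m j (corner_shift D X) (corner_shift D Y).
Proof.
move=> XY; rewrite /corner_shift (mx_congr_red idm hred XY).
exact: mx_congrD XY (mx_congr_refl _ _ _).
Qed.

Lemma corner_shift_sym D X : D^T = D -> X^T = X ->
  (corner_shift D X)^T = corner_shift D X.
Proof.
move=> sD sX; rewrite /corner_shift linearD /= sX !trmx_mul trmxK.
by rewrite tr_block_mx !trmx0 sD mulmxA.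
Qed.

End SchurReduction.

(** * The law of the Schur complement given the rank *)

Section ConditionalLaw.
Variables (R : realType) (O : comNzRingType) (m : set O).
Hypothesis hlocal : is_local_ring m.
Hypothesis hcompact : compact [set: adic R m].
Variables (F : finFieldType) (red : {rmorphism O -> F}).
Hypothesis hred : is_residue_map m red.
Variables r k : nat.
Variables (d : measure_display) (T : measurableType d) (P : probability T R).
Variable M : T -> 'M[O]_(r + k).
Hypothesis hM : uniform_law m setT P setT M.

Let idm : is_ideal m. Proof. by case: hlocal => -[]. Qed.

Lemma measurable_rank_event : measurable [set w | rank_q red (M w) = r].
Proof.
have : <<s @cylinders _ m (r + k) (r + k) >> [set X | rank_q red X = r].
  apply: (saturated_cylinders hcompact (j := 0)) => X Y XY /=.
  by rewrite /rank_q (mx_congr_red idm hred XY).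
by move=> /(uniform_law_unique hcompact hM hM)[_].
Qed.

(** The event contains the congruence class of the partial identity matrix, whose
mass is positive because N times it is 1. *)
Lemma rank_event_neq0 : P [set w | rank_q red (M w) = r] != 0%E.
Proof.
have [N NP] := uniform_law_cylinder hcompact setT (r + k) 0.
pose Z : 'M[O]_(r + k) := pid_mx r.
have symZ : sym_over setT (r + k) Z by split=> //; exact: tr_pid_mx.
have := NP _ _ _ _ _ _ hM symZ; rewrite setTI probability_setT => PZ.
apply/eqP => P0; move: PZ; rewrite (_ : P _ = 0%E) ?mule0.
  by move=> /eqP; rewrite onee_eq0.
have [_ _ mX _] := hM; have := mX 0%N Z; rewrite setTI => mZ.
apply/eqP; rewrite -measure_le0 -P0; apply: le_measure; rewrite ?inE//.
  exact: measurable_rank_event.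
move=> w /= /(mx_congr_red idm hred) MZ; rewrite /rank_q MZ map_pid_mx.
by rewrite rank_pid_mx ?leq_addr.
Qed.

Variables U V : 'M[F]_(r + k) -> 'M[O]_(r + k).
Variable inv : 'M[O]_r -> 'M[O]_r.
Hypothesis UV : forall A, U A *m V A = 1%:M.
Hypothesis VU : forall A, V A *m U A = 1%:M.
Hypothesis U_split : forall A, symmetric_of_rank A ->
  exists2 B : 'M[F]_r, B \in unitmx &
  map_mx red (U A) *m A *m (map_mx red (U A))^T = block_mx B 0 0 0.
Hypothesis invP : forall A, map_mx red A \in unitmx ->
  A *m inv A = 1%:M /\ inv A *m A = 1%:M.

Let phi X := schur inv (congruent_form red U X).

(** The shift permutes the congruence classes of symmetric matrices of each
level, its inverse being the shift by - D. *)
Lemma corner_shift_uniform D : sym_over m k D ->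
  uniform_law m setT P setT (corner_shift red V D \o M).
Proof.
move=> hD; have [_ symM mM PM] := hM.
have hND : sym_over m k (- D).
  have [sD mD] := hD; split=> [|i l]; first by rewrite linearN /= sD.
  by rewrite mxE -mulN1r; case: idm => _ _; apply; exact: mD.
have pull j Z :
    setT `&` [set w | mx_congr m j ((corner_shift red V D \o M) w) Z] =
    setT `&` [set w | mx_congr m j (M w) (corner_shift red V (- D) Z)].
  congr (_ `&` _); apply/seteqP; split=> w /= MZ.
  - rewrite -(corner_shiftK hred (D := D) (D' := - D) V (M w)) ?subrr//.
    exact: (corner_shift_congr hlocal hred).
  - rewrite -(corner_shiftK hred (D := - D) (D' := D) V Z) ?addNr//.
    exact: (corner_shift_congr hlocal hred).
split=> // [w _|j Z|j Z Z' [sZ _] [sZ' _]].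
- by split=> //; apply: corner_shift_sym; [case: hD|case: (symM w I)].
- by rewrite pull.
- rewrite !pull; apply: PM; split=> //; apply: corner_shift_sym => //;
  by case: hND.
Qed.

(* Symmetry is imposed on the reduction only, to make the slice a union of
   congruence classes; on the values of M it holds automatically. *)
Let slice j D :=
  [set X | symmetric_of_rank (map_mx red X) /\ mx_congr m j (phi X) D].

Let slice_cylinders j D : <<s @cylinders _ m (r + k) (r + k) >> (slice j D).
Proof.
apply: (saturated_cylinders hcompact (j := j)) => X Y XY [goodX XD]; split.
  by rewrite -(mx_congr_red idm hred XY).
apply: mx_congr_trans XD; apply: mx_congr_sym.
exact: (schur_congr hlocal hred U_split invP).
Qed.

(** The shift by D - D' carries the slice over D' onto the slice over D and
preserves the law of M, so both slices have the same mass. *)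
Lemma schur_uniform :
  uniform_law m m P [set w | rank_q red (M w) = r] (phi \o M).
Proof.
have [_ symM _ _] := hM.
have good w : rank_q red (M w) = r -> symmetric_of_rank (map_mx red (M w)).
  by split=> //; rewrite map_trmx; have [-> _] := symM w I.
have sliceE j D : [set w | rank_q red (M w) = r] `&`
    [set w | mx_congr m j ((phi \o M) w) D] = setT `&` M @^-1` (slice j D).
  by rewrite setTI; apply/seteqP; split=> w /= [rw Mw]; split=> //;
     [exact: good|case: rw].
have mslice j D : measurable (setT `&` M @^-1` slice j D).
  by have [] := uniform_law_unique hcompact hM hM (slice_cylinders j D).
split.
- exact: measurable_rank_event.
- move=> w /good gw; rewrite /= /phi; apply: (schur_sym hred U_split invP) => //.
  by have [] := symM w I.
- by move=> j D; rewrite sliceE.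
- move=> j D D' hD hD'; rewrite !sliceE.
  have hE : sym_over m k (D - D').
    have [[sD mD] [sD' mD']] := (hD, hD').
    split=> [|i l]; first by rewrite linearB /= sD sD'.
    case: idm => _ aD aM; rewrite !mxE; apply: aD => //.
    by rewrite -mulN1r; exact: aM.
  have [_ _] := uniform_law_unique hcompact hM (corner_shift_uniform hE)
    (slice_cylinders j D).
  rewrite probability_setT mul1e => ->; rewrite setTI; congr (P _).
  apply/seteqP; split=> w /=; rewrite /slice /= (corner_shift_red hred)// /phi.
  + rewrite (corner_shift_schur hred _ UV _ hE)// => -[gw MD]; split=> //.
    have := mx_congrD MD (mx_congr_refl _ _ (D' - D)).
    by rewrite -[D' - D]opprB addrK opprB [D + _]addrC subrK.
  + rewrite (corner_shift_schur hred _ UV _ hE)// => -[gw MD]; split=> //.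
    have := mx_congrD MD (mx_congr_refl _ _ (D - D')).
    by rewrite [D' + _]addrC subrK.
Qed.

Variables (d' : measure_display) (T' : measurableType d').
Variable P' : probability T' R.
Variable K : T' -> 'M[O]_k.
Hypothesis hK : uniform_law m m P' setT K.
Variable C : lmodType O -> Prop.
Hypothesis hC : iso_invariant C.
Hypothesis hCK : coker_event R m m k C.

Let coker_eventE : K @^-1` (sym_over m k `&` [set X | C (coker X)]) =
  [set w | C (coker (K w))].
Proof.
have [_ symK _ _] := hK.
by apply/seteqP; split=> w /=; [case|split=> //; exact: symK].
Qed.

Lemma measurable_coker_event : measurable [set w | C (coker (K w))].
Proof.
have [_] := uniform_law_unique hcompact hK hK
  (matrix_measurable_cylinders hcompact hCK).
by rewrite coker_eventE.
Qed.

(** The Schur complement transports the event on coker M to one on a symmetric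
matrix over m, where its law is that of K times the mass of the rank event. *)
Lemma coker_and_rank :
  P ([set w | C (coker (M w))] `&` [set w | rank_q red (M w) = r]) =
  (P [set w | rank_q red (M w) = r] * P' [set w | C (coker (K w))])%E.
Proof.
have [_ symM _ _] := hM; have [_ symphi _ _] := schur_uniform.
have [_ _] := uniform_law_unique hcompact schur_uniform hK
  (matrix_measurable_cylinders hcompact hCK).
rewrite coker_eventE => <-; congr (P _); rewrite setIC; apply/seteqP.
have iso w : rank_q red (M w) = r ->
    module_iso (coker (M w)) (coker (phi (M w))).
  move=> rw; apply: (schur_coker UV VU U_split invP); split=> //.
  by rewrite map_trmx; have [-> _] := symM w I.
split=> w /= [rw Cw]; split=> //.
- by split; [exact: symphi|exact: hC (iso w rw) Cw].
- by case: Cw => _; apply: hC; exact/module_iso_sym/iso.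
Qed.

End ConditionalLaw.

Theorem proposition4p5 (R : realType) (O : comNzRingType) (m : set O)
    (hlocal : is_local_ring m) (hnoeth : is_noetherian O)
    (hcompact : compact [set: adic R m])
    (F : finFieldType) (red : {rmorphism O -> F}) (hred : is_residue_map m red)
    (n k : nat) (hk : (k <= n)%N)
    (d : measure_display) (T : measurableType d) (P : probability T R)
    (M : T -> 'M[O]_n) (hM : SymHaar m setT P M)
    (d' : measure_display) (T' : measurableType d') (P' : probability T' R)
    (K : T' -> 'M[O]_k) (hK : SymHaar m m P' K)
    (C : lmodType O -> Prop) (hC : iso_invariant C)
    (hCM : coker_event R m setT n C) (hCK : coker_event R m m k C) :
  cond_prob P [set w | C (coker (M w))] [set w | rank_q red (M w) = (n - k)%N]
  = fine (P' [set w | C (coker (K w))]).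
Proof.
move: (n - k)%N (subnK hk) => r En; subst n => {hk hCM}.
have idm : is_ideal m by case: hlocal => -[].
have uM := SymHaar_uniform (And3 I (fun _ _ _ _ => I) (fun _ _ _ => I)) hM.
have uK := SymHaar_uniform idm hK.
have [U [V [UV VU U_split]]] := residue_splitting hlocal hred r k.
have [inv invP] := residue_inverse hlocal hred r.
rewrite /cond_prob (coker_and_rank hlocal hcompact hred uM UV VU U_split invP uK)//.
have P0 := rank_event_neq0 hlocal hcompact hred uM.
have mC := measurable_coker_event hcompact uK hCK.
have mB := measurable_rank_event hlocal hcompact hred uM.
rewrite fineM ?fin_num_measure// mulrAC divff ?mul1r// fine_eq0//.
exact: fin_num_measure.
Qed.
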